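(* Let $A=\mathcal{P}_\Omega(M+X)$ be the observed matrix with $M\in[0,1]^{m\times n}$ and sampling rate $\delta$, its columns being presented in uniformly random order. Assume: (i) $\|M\|_F^2=\Theta(mn)$; (ii) there exists $i\le\min(n,m)$ such that $\frac{s_i(M)}{s_{i+1}(M)}=\omega(1)$ and $\sum_{j=i+1}^{\min(m,n)}s_j^2(M)=o(mn)$, and $k$ denotes the smallest such $i$; (iii) $\delta=\omega\left(k\max\left(\frac1n,\frac{\log^2 m}{m}\right)\right)$ and $\delta=o\left(\frac{1}{\log^2 m}\right)$. Let $\ell=\frac{k}{\delta\log(m)}$. Then, with high probability, the computational complexity of the algorithm SMC run with parameters $k$ and $\ell$ is $O(\delta kmn)$.
   Context: Asymptotics: $m,n\to\infty$, and all other quantities ($\delta$, $k$, $\ell$, $M$, ...) may depend on $m,n$; $o,O,\omega,\Omega,\Theta$ refer to this limit, and ''with high probability'' means with probability tending to $1$. Complexity is counted in floating-point operations, with products involving sparse matrices costing only the operations on non-zero entries. The output of the algorithm is the pair of factors $\hat U$ ($m\times k$) and $\hat V$ ($n\times k$). Notation: $A^\dagger$ is the transpose; $s_1(A)\ge s_2(A)\ge\dots$ are singular values; $\|\cdot\|_F$ is the Frobenius norm. $A_i$ and $A^j$ are the $i$-th column and $j$-th row of $A$; $A^{a:b}$ is the submatrix of rows $a,\dots,b$. Observation model: $X$ has independent zero-mean entries with $M_{ij}+X_{ij}\in[0,1]$. Each entry belongs to the random set $\Omega$ independently with probability $\delta$; $[\mathcal{P}_\Omega(Y)]_{ij}=Y_{ij}$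 if $(i,j)\in\Omega$ and $0$ otherwise. Streaming model: columns of $A$ arrive one at a time, each arriving column being uniformly distributed among those not yet observed; columns of $A$ are indexed in order of arrival. SPCA (input $B\in[0,1]^{m\times\ell}$, $k$): $\hat\delta_B\leftarrow\frac{1}{m\ell}\sum_{(i,j)}1(B_{ij}>0)$; $\tilde B\leftarrow B$ with rows having more than $\max\{10,10\hat\delta_B\ell\}$ non-zero entries erased; $\Phi\leftarrow\tilde B^\dagger\tilde B-\mathrm{diag}(\tilde B^\dagger\tilde B)$; start from a random $\ell\times k$ matrix $Q^{(0)}$ with orthonormal columns, and for $\tau=1,\dots,\lceil10\log\ell\rceil$ let $Q^{(\tau)}R^{(\tau)}$ be the QR decomposition of $\Phi Q^{(\tau-1)}$; output the last $Q^{(\tau)}$. Split$(B,a,b,\delta')$: creates $B^{(1)},\dots,B^{(a)}$, initially zero matrices of the size of $B$. For each entry $(u,v)$ independently, a random subset $\gamma\subset\{1,\dots,b\}$ is drawn, equal to a non-empty $s$ with probability $\frac{1}{\delta'}(\frac{\delta'}{b})^{|s|}(1-\frac{\delta'}{b})^{b-|s|}$ and empty with probability $1-\frac{1}{\delta'}(1-(1-\frac{\delta'}{b})^b)$; then $[B^{(i)}]_{uv}\leftarrow B_{uv}$ for every $i\in\gamma$ (with $i\le a$). In the analysis, the outputs with $b=4$ are regarded as independent given $M+X$, each distributed as the original sampled matrix with $\delta$ replaced by $\delta/4$. SMC (parameters $k,\ell$): (1) $A^{(B)}=[A_1,\dots,A_\ell]$; (2) $\hat\delta=\frac{1}{m\ell}\sum_{(i,j)}1([A^{(B)}]_{ij}>0)$;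 (3) $A^{(B_1)},\dots,A^{(B_4)}\leftarrow$ Split$(A^{(B)},4,4,\hat\delta)$; (4) $Q\leftarrow$ SPCA$(A^{(B_1)},k)$; (5) in $A^{(B_2)}$, set to zero the rows having more than two observed entries, then set to zero the columns having more than $10m\hat\delta$ non-zero entries; (6) $W\leftarrow A^{(B_2)}Q$; (7) $\hat V^{1:\ell}\leftarrow(A^{(B_3)})^\dagger W$; (8) $\hat I\leftarrow A^{(B_4)}\hat V^{1:\ell}$; for each $t=\ell+1,\dots,n$: (9) $A_t^{(1)},A_t^{(2)}\leftarrow$ Split$(A_t,2,4,\hat\delta)$; (10) $\hat V^t\leftarrow(A_t^{(1)})^\dagger W$; (11) $\hat I\leftarrow\hat I+A_t^{(2)}\hat V^t$; finally (12) using the Gram-Schmidt process find a $k\times k$ matrix $\hat R$ such that $\hat V\hat R$ has orthonormal columns, where $\hat V$ is the $n\times k$ matrix with rows $\hat V^1,\dots,\hat V^n$; (13) $\hat U\leftarrow\frac{4}{\hat\delta}\hat I\hat R\hat R^\dagger$. *)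

(* Defs.v *)
From HB Require Import structures.
From mathcomp Require Import all_boot all_order all_algebra all_fingroup.
From mathcomp Require Import all_classical all_reals all_analysis.

Set Implicit Arguments.
Unset Strict Implicit.
Unset Printing Implicit Defensive.

Import Order.TTheory GRing.Theory Num.Theory.
Import numFieldNormedType.Exports.

Local Open Scope classical_set_scope.
Local Open Scope ring_scope.

(* A [flops T] is an instrumented computation: the number of elementary
   operations it executes, paired with its result.  Costs only ever come from
   the scalar primitives below (arithmetic, square root, comparison: one unit
   each) and from [charge], used for random draws.  Indexing, transposing,
   copying and overwriting entries by zero are data movement, not arithmetic. *)
Definition flops (T : Type) : Type := (nat * T)%type.
Definition cost T (p : flops T) : nat := p.1.
Definition result T (p : flops T) : T := p.2.
Definition ret T (x : T) : flops T := (0%N, x).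
Definition bind T U (p : flops T) (f : T -> flops U) : flops U :=
  ((cost p + cost (f (result p)))%N, result (f (result p))).
Definition charge (c : nat) T (x : T) : flops T := (c, x).

Notation "'let!' x := p 'in' q" := (bind p (fun x => q))
  (at level 200, x name, p at level 100, q at level 200).

Fixpoint foldM (I S : Type) (f : S -> I -> flops S) (x : S) (s : seq I) :
    flops S :=
  if s is i :: s' then let! y := f x i in foldM f y s' else ret x.

(* Tabulation of a matrix, each entry being computed separately. *)
Definition mxM T p q (F : 'I_p -> 'I_q -> flops T) : flops 'M[T]_(p, q) :=
  ((\sum_(i < p) \sum_(j < q) cost (F i j))%N,
   \matrix_(i, j) result (F i j)).

Section Kernels.
Variable R : realType.

Definition fadd (x y : R) : flops R := charge 1 (x + y).
Definition fsub (x y : R) : flops R := charge 1 (x - y).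
Definition fmul (x y : R) : flops R := charge 1 (x * y).
Definition fdiv (x y : R) : flops R := charge 1 (x / y).
Definition fsqrt (x : R) : flops R := charge 1 (Num.sqrt x).
Definition fmax (x y : R) : flops R := charge 1 (Num.max x y).
Definition flt (x y : R) : flops bool := charge 1 (x < y).

(* Dense kernels: all entries are visited, zero or not. *)
Definition gemm p q r (S : 'M[R]_(p, q)) (D : 'M[R]_(q, r)) :
    flops 'M[R]_(p, r) :=
  mxM (fun i j => foldM (fun acc u =>
    let! x := fmul (S i u) (D u j) in fadd acc x) 0 (enum 'I_q)).

Definition mxsubM p q (Y Z : 'M[R]_(p, q)) : flops 'M[R]_(p, q) :=
  mxM (fun i j => fsub (Y i j) (Z i j)).

Definition scaleM p q (a : R) (Y : 'M[R]_(p, q)) : flops 'M[R]_(p, q) :=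
  mxM (fun i j => fmul a (Y i j)).

Definition dotM p (v w : 'cV[R]_p) : flops R :=
  foldM (fun acc u => let! x := fmul (v u 0) (w u 0) in fadd acc x) 0 (enum 'I_p).

(* Sparse kernels: only the non-zero entries of the sparse operand are
   visited. *)
Definition nz_row p q (S : 'M[R]_(p, q)) (i : 'I_p) : seq 'I_q :=
  [seq u <- enum 'I_q | S i u != 0].

Definition nnz p q (S : 'M[R]_(p, q)) : nat :=
  #|[set x : 'I_p * 'I_q | S x.1 x.2 != 0]|.

(* [spmm_add Y S D] is [Y + S D] with [S] sparse. *)
Definition spmm_add p q r (Y : 'M[R]_(p, r)) (S : 'M[R]_(p, q))
    (D : 'M[R]_(q, r)) : flops 'M[R]_(p, r) :=
  mxM (fun i j => foldM (fun acc u =>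
    let! x := fmul (S i u) (D u j) in fadd acc x) (Y i j) (nz_row S i)).

Definition spmm p q r (S : 'M[R]_(p, q)) (D : 'M[R]_(q, r)) :
    flops 'M[R]_(p, r) := spmm_add 0 S D.

(* Diagonal of [S^T S]. *)
Definition sp_colsq p q (S : 'M[R]_(p, q)) : flops 'cV[R]_q :=
  mxM (fun t _ => foldM (fun acc u =>
    let! x := fmul (S u t) (S u t) in fadd acc x) 0 (nz_row S^T t)).

(* Fraction of positive entries. *)
Definition density p q (S : 'M[R]_(p, q)) : flops R :=
  let! c := foldM (fun acc _ => fadd acc 1) 0
              [seq x <- enum (('I_p * 'I_q)%type : finType) | 0 < S x.1 x.2] in
  let! pq := fmul p%:R q%:R in
  fdiv c pq.

(* Zero out the rows (columns) with more than [thr] non-zero entries. *)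
Definition erase_rows p q (thr : R) (S : 'M[R]_(p, q)) : flops 'M[R]_(p, q) :=
  let! big := mxM (fun i (_ : 'I_1) =>
    let! c := foldM (fun acc _ => fadd acc 1) 0 (nz_row S i) in flt thr c) in
  ret (\matrix_(i, j) if big i 0 then 0 else S i j).

Definition erase_cols p q (thr : R) (S : 'M[R]_(p, q)) : flops 'M[R]_(p, q) :=
  let! St := erase_rows thr S^T in ret St^T.

(* Householder QR.  [hh_reflect v Y] is [(1 - 2 v v^T / (v^T v)) Y]; when [v = 0]
   it is [Y], since [x / 0 = 0]. *)
Definition hh_reflect p q (v : 'cV[R]_p) (Y : 'M[R]_(p, q)) : flops 'M[R]_(p, q) :=
  let! vv := dotM v v in
  let! b := fdiv 2 vv in
  let! w := gemm v^T Y in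
  let! bw := scaleM b w in
  let! Z := gemm v bw in
  mxsubM Y Z.

Definition hh_vector p q (Y : 'M[R]_(p, q)) (j : 'I_q) : flops 'cV[R]_p :=
  let x := \col_i (if (i < j)%N then 0 else Y i j) in
  let! xx := dotM x x in
  let! nrm := fsqrt xx in
  mxM (fun i (o : 'I_1) =>
    if (i == j :> nat)%N
    then let! neg := flt (x i o) 0 in
         if neg then fsub (x i o) nrm else fadd (x i o) nrm
    else ret (x i o)).

Definition hh_step p q (st : 'M[R]_(p, q) * seq 'cV[R]_p) (j : 'I_q) :
    flops ('M[R]_(p, q) * seq 'cV[R]_p) :=
  let! v := hh_vector st.1 j in
  let! Y := hh_reflect v st.1 in
  ret (Y, v :: st.2).

(* [(Q, R)] with [Y = Q R], [Q] of size [p x q] with orthonormal columns and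
   [R] upper triangular of size [q x q] (for [q <= p]). *)
Definition qr p q (Y : 'M[R]_(p, q)) : flops ('M[R]_(p, q) * 'M[R]_q) :=
  let! st := foldM (@hh_step p q) (Y, [::]) (enum 'I_q) in
  let! Q := foldM (fun Z v => hh_reflect v Z) (pid_mx q : 'M[R]_(p, q)) st.2 in
  ret (Q, (pid_mx q : 'M[R]_(q, p)) *m st.1).

(* Gram-Schmidt on the columns of [V], keeping for each orthonormal vector the
   coefficients expressing it in the columns of [V]: the state lists the pairs
   [(V c, c)].  If [V] does not have full column rank, no [Rhat] with
   orthonormal [V Rhat] exists; dependent columns then yield zero vectors. *)
Definition gs_step p q (V : 'M[R]_(p, q)) (st : seq ('cV[R]_p * 'cV[R]_q))
    (j : 'I_q) : flops (seq ('cV[R]_p * 'cV[R]_q)) :=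
  let! vc := foldM (fun (vc : 'cV[R]_p * 'cV[R]_q) qa =>
      let! r := dotM qa.1 vc.1 in
      let! rq := scaleM r qa.1 in
      let! v := mxsubM vc.1 rq in
      let! ra := scaleM r qa.2 in
      let! c := mxsubM vc.2 ra in
      ret (v, c)) (col j V, delta_mx j 0) st in
  let! vv := dotM vc.1 vc.1 in
  let! nrm := fsqrt vv in
  let! v := mxM (fun i o => fdiv (vc.1 i o) nrm) in
  let! c := mxM (fun i o => fdiv (vc.2 i o) nrm) in
  ret (rcons st (v, c)).

Definition gram_schmidt p q (V : 'M[R]_(p, q)) : flops 'M[R]_q :=
  let! st := foldM (gs_step V) [::] (enum 'I_q) in
  ret (\matrix_(i, j) (nth (0, 0) st j).2 i 0).

End Kernels.

Section Algorithm.
Variable R : realType.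

(* Output [i : 'I_a] keeps the entries whose drawn subset of ['I_b] contains
   [i].  One draw per non-zero entry is charged: the copies of a zero entry are
   zero whatever its draw. *)
Definition split (a b : nat) p q (gamma : 'I_p -> 'I_q -> {set 'I_b})
    (B : 'M[R]_(p, q)) : flops ('I_a -> 'M[R]_(p, q)) :=
  charge (nnz B) (fun i : 'I_a =>
    \matrix_(u, v) if [exists c in gamma u v, c == i :> nat] then B u v else 0).

(* Probability that a draw is equal to [s]. *)
Definition split_prob (b : nat) (delta' : R) (s : {set 'I_b}) : R :=
  let x := delta' / b%:R in
  if s == finset.set0 then 1 - delta'^-1 * (1 - (1 - x) ^+ b)
  else delta'^-1 * (x ^+ #|s| * (1 - x) ^+ (b - #|s|)).

(* [Phi Q] for [Phi = S^T S - diag (S^T S)], evaluated through products with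
   the sparse matrix [S]; [d] is the precomputed diagonal of [S^T S].  See
   [phi_mulE] below. *)
Definition phi_mul p q r (S : 'M[R]_(p, q)) (d : 'cV[R]_q) (Q : 'M[R]_(q, r)) :
    flops 'M[R]_(q, r) :=
  let! SQ := spmm S Q in
  let! StSQ := spmm S^T SQ in
  let! dQ := mxM (fun t j => fmul (d t 0) (Q t j)) in
  mxsubM StSQ dQ.

(* The random orthonormal starting matrix is the orthonormal QR factor of the
   random seed [G] (for a Gaussian [G], a uniformly distributed one). *)
Definition SPCA m l k (G : 'M[R]_(l, k)) (B : 'M[R]_(m, l)) :
    flops 'M[R]_(l, k) :=
  let! dB := density B in
  let! dl := fmul dB l%:R in
  let! dl10 := fmul 10 dl in
  let! thr := fmax 10 dl10 in
  let! Bt := erase_rows thr B in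
  let! d := sp_colsq Bt in
  let! seed := charge (l * k) G in
  let! Q0 := qr seed in
  foldM (fun Q _ => let! Z := phi_mul Bt d Q in
                    let! QR := qr Z in
                    ret QR.1)
        Q0.1 (iota 0 `|Num.ceil (10 * ln (l%:R : R))|%N).

(* Restriction to the first [l] columns, padded with zero columns in the
   irrelevant case [n < l]. *)
Definition first_cols (l m n : nat) (A : 'M[R]_(m, n)) : 'M[R]_(m, l) :=
  \matrix_(u, t) if insub (t : nat) is Some t' then A u t' else 0.

Definition first_draws (l m n : nat) (gamma : 'I_m * 'I_n -> {set 'I_4})
    (u : 'I_m) (t : 'I_l) : {set 'I_4} :=
  if insub (t : nat) is Some t' then gamma (u, t') else finset.set0.

Definition batch_density (l m n : nat) (A : 'M[R]_(m, n)) : flops R :=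
  density (first_cols l A).

(* Processing of the column [A_t], [t > l]. *)
Definition smc_column m n k (A : 'M[R]_(m, n))
    (gamma : 'I_m * 'I_n -> {set 'I_4}) (W : 'M[R]_(m, k))
    (st : 'M[R]_(m, k) * 'M[R]_(n, k)) (t : 'I_n) :
    flops ('M[R]_(m, k) * 'M[R]_(n, k)) :=
  let! At := split 2 (fun u (_ : 'I_1) => gamma (u, t)) (col t A) in
  let! v := spmm (At 0)^T W in
  let! I := spmm_add st.1 (At 1) v in
  ret (I, \matrix_(s, j) if s == t then v 0 j else st.2 s j).

(* [A] is the matrix of observations, columns in order of arrival; [gamma]
   holds the draws of all calls to [split] (the call on an entry is determined
   by its column); [G] is the seed of SPCA. *)
Definition SMC m n k l (A : 'M[R]_(m, n)) (gamma : 'I_m * 'I_n -> {set 'I_4})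
    (G : 'M[R]_(l, k)) : flops ('M[R]_(m, k) * 'M[R]_(n, k)) :=
  let AB := first_cols l A in
  let! dhat := batch_density l A in
  let! B := split 4 (@first_draws l m n gamma) AB in
  let! Q := SPCA G (B 0) in
  let! B2r := erase_rows 2 (B 1) in
  let! md := fmul m%:R dhat in
  let! md10 := fmul 10 md in
  let! B2 := erase_cols md10 B2r in
  let! W := spmm B2 Q in
  let! V0 := spmm (B 2)^T W in
  let! I0 := spmm (B 3) V0 in
  let! st := foldM (smc_column A gamma W)
      (I0, \matrix_(t, j) if insub (t : nat) is Some t' then V0 t' j else 0)
      [seq t : 'I_n <- enum 'I_n | (l <= t)%N] in
  let! Rhat := gram_schmidt st.2 in
  let! IR := gemm st.1 Rhat in
  let! IRR := gemm IR Rhat^T in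
  let! c := fdiv 4 dhat in
  let! U := scaleM c IRR in
  ret (U, st.2).

End Algorithm.

Section KernelFacts.
Variable R : realType.

Lemma bindE T U (p : flops T) (f : T -> flops U) :
  result (bind p f) = result (f (result p)).
Proof. by []. Qed.

Lemma foldM_mulE (I : Type) (F G : I -> R) (a : R) (s : seq I) :
  result (foldM (fun acc i => let! x := fmul (F i) (G i) in fadd acc x) a s) =
  a + \sum_(i <- s) F i * G i.
Proof.
elim: s a => [|i s IH] a /=; first by rewrite big_nil addr0.
by rewrite IH big_cons addrA.
Qed.

Lemma gemmE p q r (S : 'M[R]_(p, q)) (D : 'M[R]_(q, r)) :
  result (gemm S D) = S *m D.
Proof.
by apply/matrixP => i j; rewrite mxE foldM_mulE add0r mxE big_enum.
Qed.

Lemma spmm_addE p q r (Y : 'M[R]_(p, r)) (S : 'M[R]_(p, q))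
    (D : 'M[R]_(q, r)) :
  result (spmm_add Y S D) = Y + S *m D.
Proof.
apply/matrixP => i j; rewrite !mxE foldM_mulE; congr (_ + _).
rewrite big_filter big_enum_cond [RHS](bigID (fun u => S i u != 0)) /=.
rewrite [X in _ + X]big1 ?addr0 // => u.
by rewrite negbK => /eqP ->; rewrite mul0r.
Qed.

Lemma spmmE p q r (S : 'M[R]_(p, q)) (D : 'M[R]_(q, r)) :
  result (spmm S D) = S *m D.
Proof. by rewrite spmm_addE add0r. Qed.

Lemma sp_colsqE p q (S : 'M[R]_(p, q)) t :
  result (sp_colsq S) t 0 = (S^T *m S) t t.
Proof.
rewrite !mxE foldM_mulE add0r big_filter big_enum_cond.
rewrite [RHS](bigID (fun u => S^T t u != 0)) /=.
rewrite [X in _ + X]big1 ?addr0 => [|u].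
  by apply: eq_bigr => u _; rewrite mxE.
by rewrite negbK => /eqP ->; rewrite mul0r.
Qed.

Lemma phi_mulE p q r (S : 'M[R]_(p, q)) (Q : 'M[R]_(q, r)) :
  result (phi_mul S (result (sp_colsq S)) Q) =
  (S^T *m S - diag_mx (\row_t (S^T *m S) t t)) *m Q.
Proof.
have mxsubME (Y Z : 'M[R]_(q, r)) : result (mxsubM Y Z) = Y - Z.
  by apply/matrixP => i j; rewrite !mxE.
rewrite /phi_mul !bindE mxsubME !spmmE mulmxBl mulmxA; congr (_ - _).
rewrite mul_diag_mx; apply/matrixP => i j.
by rewrite [LHS]mxE /= sp_colsqE !mxE.
Qed.

End KernelFacts.

Section Model.
Variable R : realType.

Definition sample m n (Om : {set 'I_m * 'I_n}) (Y : 'M[R]_(m, n)) :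
    'M[R]_(m, n) :=
  \matrix_(i, j) if (i, j) \in Om then Y i j else 0.

(* Joint law of the noise [X], the sampled set [Om], the order of arrival [sg]
   (the [t]-th arriving column is column [sg t]), the draws [gamma] and the
   seed [G]. *)
Record smc_model d (T : measurableType d) (P : probability T R) (m n k l : nat)
    (delta : R) (M : 'M[R]_(m, n)) (X : 'I_m -> 'I_n -> {RV P >-> R})
    (Om : T -> {set 'I_m * 'I_n}) (sg : T -> 'S_n)
    (gamma : T -> {ffun 'I_m * 'I_n -> {set 'I_4}}) (G : T -> 'M[R]_(l, k))
    (A : T -> 'M[R]_(m, n)) : Prop := SmcModel {
  arrivalE : forall w,
    A w = col_perm (sg w) (sample (Om w) (M + \matrix_(i, j) X i j w));
  noise_mean0 : forall i j, ('E_P[X i j] = 0)%E;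
  noise_range : forall i j w, 0 <= M i j + X i j w <= 1;
  measurable_Om : forall S, measurable (Om @^-1` [set S]);
  measurable_sg : forall s, measurable (sg @^-1` [set s]);
  measurable_gamma : forall g, measurable (gamma @^-1` [set g]);
  measurable_G : forall i j, measurable_fun setT (fun w => G w i j);
  (* The noise entries, the sampling indicators (Bernoulli of mean [delta]) and
     the uniformly random order of arrival are mutually independent. *)
  sampling_law : forall (B : 'I_m -> 'I_n -> set R) S s,
    (forall i j, measurable (B i j)) ->
    P [set w | [/\ forall i j, B i j (X i j w), Om w = S & sg w = s]] =
    ((\prod_(i < m) \prod_(j < n) P (X i j @^-1` B i j)) *
     (delta ^+ #|S| * (1 - delta) ^+ (m * n - #|S|) * (n`!%:R)^-1)%:E)%E;
  (* Given the noise, the sampled set and the order of arrival, the draws are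
     independent with law [split_prob 4 dhat], and the seed is independent of
     everything else. *)
  draws_law : forall (B : 'I_m -> 'I_n -> set R) S s dhat g
      (D : 'I_l -> 'I_k -> set R),
    (forall i j, measurable (B i j)) -> (forall i j, measurable (D i j)) ->
    let E := [set w | [/\ forall i j, B i j (X i j w), Om w = S, sg w = s &
                          result (batch_density l (A w)) = dhat]] in
    P (E `&` [set w | gamma w = g] `&` [set w | forall i j, D i j (G w i j)]) =
    (P E * (\prod_(x : 'I_m * 'I_n) split_prob dhat (g x))%:E *
     P [set w | forall i j, D i j (G w i j)])%E }.

(* [s] lists the square roots of the eigenvalues of [M^T M], with multiplicity
   and in decreasing order.  Beyond [min m n] the entries are zero. *)
Definition singular_values m n (M : 'M[R]_(m, n)) (s : seq R) : Prop :=
  [/\ sorted >=%R s, (forall x, x \in s -> 0 <= x) &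
      char_poly (M^T *m M) = \prod_(x <- s) ('X - (x ^+ 2)%:P)].

Definition frob2 m n (M : 'M[R]_(m, n)) : R := \sum_(i < m) \sum_(j < n) M i j ^+ 2.

(* With [sigma N i] the [i]-th singular value of the [N]-th matrix (numbered
   from 1), [s_i / s_{i+1} = omega(1)] and [sum_{j > i} s_j^2 = o(m n)] along
   the sequence of indices [i N].  The strict inequality makes the ratio
   infinite when [s_{i+1} = 0 < s_i] and excludes the form [0 / 0]. *)
Definition spectral_gap (m n : nat -> nat) (sigma : nat -> nat -> R)
    (i : nat -> nat) : Prop :=
  [/\ (\forall N \near \oo, (1 <= i N <= minn (m N) (n N))%N),
      (forall C : R, \forall N \near \oo, C * sigma N (i N).+1 < sigma N (i N)) &
      (fun N => \sum_((i N).+1 <= j < (minn (m N) (n N)).+1) sigma N j ^+ 2)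
        =o_\oo (fun N => (m N * n N)%:R : R)].

Definition smallest_spectral_gap (m n : nat -> nat) (sigma : nat -> nat -> R)
    (k : nat -> nat) : Prop :=
  spectral_gap m n sigma k /\
  (forall i, spectral_gap m n sigma i -> \forall N \near \oo, (k N <= i N)%N).

(* Probability tending to 1; formulated through measurable subsets so that the
   events themselves need not be shown measurable. *)
Definition whp (d : nat -> measure_display)
    (T : forall N, measurableType (d N)) (P : forall N, probability (T N) R)
    (E : forall N, set (T N)) : Prop :=
  forall eps : R, 0 < eps -> \forall N \near \oo,
    exists2 F : set (T N), measurable F /\ F `<=` E N &
                           ((1 - eps)%:E <= P N F)%E.

End Model.

(* Main.v *)
Require Import Defs.
From HB Require Import structures.
From mathcomp Require Import all_boot all_order all_algebra all_fingroup.
From mathcomp Require Import all_classical all_reals all_analysis.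
From mathcomp Require Import zify ring lra.

Set Implicit Arguments.
Unset Strict Implicit.
Unset Printing Implicit Defensive.

Import Order.TTheory GRing.Theory Num.Theory.
Import numFieldNormedType.Exports.

Local Open Scope classical_set_scope.
Local Open Scope ring_scope.

(** Three facts make the cost [O (delta k m n)].

   The cost depends on the data only through the sparsity of the operands.
   Every sparse operand is obtained from the observed matrix by selecting or
   erasing entries, so that the cost is bounded by a polynomial in [m], [n],
   [k], [l], the number [z] of observed entries in the first [l] columns, the
   number [Z] of all observed entries, and the number of power iterations
   ([cost_SMC]).

   The counts concentrate.  Whatever the order of arrival, the sampled
   positions form a Bernoulli random set, so that a Chernoff bound gives
   [z <= e delta m l] and [Z <= e delta m n] except with probability
   [1 / (delta m l) + 1 / (delta m n)] ([bernoulli_tail], [observed_counts]).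
   This tends to 0 because [delta m] is eventually larger than any constant.

   The parameters balance ([cost_bound_le]).  The power iterations, [O (log l)]
   in number, cost [O (k z + l k^2)] each; since [l] is about
   [k / (delta log m)] and [log l <= log m], the two logarithms cancel and this
   part costs [O (k^2 m + k^3 / delta)].  With the [O (k Z)] operations of the
   streaming phase and the [O (k^2 (m + n))] of the final orthonormalization,
   everything is absorbed by [k <= delta n] and [k <= delta m]. *)

(** * Costs of sequencing, folds and tabulations *)

Lemma cost_bind T U (p : flops T) (f : T -> flops U) :
  cost (bind p f) = (cost p + cost (f (result p)))%N.
Proof. by []. Qed.

(** Rewriting with [cost_bind] also unfolds the kernels that are defined by
   [bind]; this tactic only splits the sequencings that are visible. *)
Ltac split_cost := repeat (match goal with
  |- context [cost (@bind ?T ?U ?p ?f)] => rewrite (@cost_bind T U p f)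
  end; cbv beta).

Section CostCalculus.
Local Open Scope nat_scope.

Lemma cost_foldM_le (I S : Type) (f : S -> I -> flops S) (c : I -> nat)
    (s : seq I) (x : S) :
  (forall y i, cost (f y i) <= c i) -> cost (foldM f x s) <= \sum_(i <- s) c i.
Proof.
move=> fc; elim: s x => [|i s IH] x; first by rewrite big_nil.
by rewrite big_cons /= leq_add.
Qed.

Lemma cost_foldM_const (I S : Type) (f : S -> I -> flops S) (c : nat)
    (s : seq I) (x : S) :
  (forall y i, cost (f y i) <= c) -> cost (foldM f x s) <= size s * c.
Proof.
move=> fc; apply: leq_trans (cost_foldM_le (c := fun=> c) s x fc) _.
by rewrite big_const_seq count_predT iter_addn_0 mulnC.
Qed.

Lemma cost_mxM_const T p q (F : 'I_p -> 'I_q -> flops T) c :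
  (forall i j, cost (F i j) <= c) -> cost (mxM F) <= p * q * c.
Proof.
move=> Fc; apply: (@leq_trans (\sum_(i < p) \sum_(j < q) c)).
  by apply: leq_sum => i _; apply: leq_sum.
by rewrite big_const_ord iter_addn_0 big_const_ord iter_addn_0; lia.
Qed.

End CostCalculus.

(** * Costs of the numerical kernels *)

Section KernelCosts.
Variable R : realType.
Local Open Scope nat_scope.

Lemma nnzE p q (S : 'M[R]_(p, q)) :
  nnz S = \sum_(i < p) \sum_(j < q) (S i j != 0%R).
Proof.
rewrite /nnz -sum1_card pair_big /= big_mkcond /=.
apply: eq_bigr => x _; have -> : (x \in in_set [set y | S y.1 y.2 != 0%R]) =
  (S x.1 x.2 != 0%R) by exact: asboolb.
by case: (_ != _).
Qed.

Lemma leq_nnz p q (S S' : 'M[R]_(p, q)) :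
  (forall i j, S i j != 0%R -> S' i j != 0%R) -> nnz S <= nnz S'.
Proof.
move=> h; rewrite !nnzE; apply: leq_sum => i _; apply: leq_sum => j _.
by have := h i j; case: (S i j != 0%R) => [->|].
Qed.

Lemma nnz_tr p q (S : 'M[R]_(p, q)) : nnz S^T%R = nnz S.
Proof.
rewrite !nnzE exchange_big; apply: eq_bigr => i _; apply: eq_bigr => j _.
by rewrite mxE.
Qed.

Lemma size_nz_row p q (S : 'M[R]_(p, q)) i :
  size (Defs.nz_row S i) = \sum_(j < q) (S i j != 0%R).
Proof. by rewrite size_filter -sum1_count big_mkcond big_enum. Qed.

Lemma sum_size_nz_row p q (S : 'M[R]_(p, q)) :
  \sum_(i < p) size (Defs.nz_row S i) = nnz S.
Proof. by rewrite nnzE; apply: eq_bigr => i _; rewrite size_nz_row. Qed.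

Lemma cost_count (I : Type) (x : R) (s : seq I) :
  cost (foldM (fun acc _ => fadd acc 1%R) x s) = size s.
Proof. by elim: s x => //= i s IH x; rewrite /cost /= -/(cost _) IH. Qed.

Lemma cost_mul_add (I : Type) (F G : I -> R) (a : R) (s : seq I) :
  cost (foldM (fun acc i => let! x := fmul (F i) (G i) in fadd acc x) a s) =
  2 * size s.
Proof.
elim: s a => // i s IH a; rewrite [foldM _ _ _]/= !cost_bind IH.
by rewrite mulnS.
Qed.

Lemma cost_gemm p q r (S : 'M[R]_(p, q)) (D : 'M[R]_(q, r)) :
  cost (gemm S D) <= p * r * (2 * q).
Proof.
by apply: cost_mxM_const => i j; rewrite cost_mul_add size_enum_ord.
Qed.

Lemma cost_mxsubM p q (Y Z : 'M[R]_(p, q)) : cost (mxsubM Y Z) <= p * q.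
Proof. by rewrite -[leqRHS]muln1; apply: cost_mxM_const. Qed.

Lemma cost_scaleM p q a (Y : 'M[R]_(p, q)) : cost (scaleM a Y) <= p * q.
Proof. by rewrite -[leqRHS]muln1; apply: cost_mxM_const. Qed.

Lemma cost_dotM p (v w : 'cV[R]_p) : cost (dotM v w) = 2 * p.
Proof. by rewrite cost_mul_add size_enum_ord. Qed.

Lemma cost_spmm_add p q r (Y : 'M[R]_(p, r)) (S : 'M[R]_(p, q))
    (D : 'M[R]_(q, r)) :
  cost (spmm_add Y S D) = 2 * r * nnz S.
Proof.
rewrite -sum_size_nz_row big_distrr /=; apply: eq_bigr => i _.
rewrite (eq_bigr (fun=> 2 * size (Defs.nz_row S i))); last first.
  by move=> j _; rewrite cost_mul_add.
by rewrite big_const_ord iter_addn_0 mulnAC.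
Qed.

Lemma cost_sp_colsq p q (S : 'M[R]_(p, q)) : cost (sp_colsq S) = 2 * nnz S.
Proof.
rewrite -nnz_tr -sum_size_nz_row big_distrr /=; apply: eq_bigr => i _.
by rewrite big_ord1 cost_mul_add.
Qed.

Lemma cost_density p q (S : 'M[R]_(p, q)) : cost (density S) <= nnz S + 2.
Proof.
rewrite /density; split_cost; rewrite cost_count leq_add2r.
rewrite size_filter -sum1_count big_mkcond big_enum nnzE pair_big /=.
by apply: leq_sum => x _; case: ifP => // /gt_eqF ->.
Qed.

Lemma cost_erase_rows p q thr (S : 'M[R]_(p, q)) :
  cost (erase_rows thr S) = nnz S + p.
Proof.
rewrite cost_bind addn0 -sum_size_nz_row -[X in _ = _ + X]muln1.
rewrite -[X in _ = _ + X * _]card_ord -sum_nat_const -big_split.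
by apply: eq_bigr => i _; rewrite big_ord1 cost_bind cost_count.
Qed.

Lemma nnz_erase_rows p q thr (S : 'M[R]_(p, q)) :
  nnz (result (erase_rows thr S)) <= nnz S.
Proof.
by apply: leq_nnz => i j; rewrite mxE; case: ifP => // _; rewrite eqxx.
Qed.

Lemma cost_erase_cols p q thr (S : 'M[R]_(p, q)) :
  cost (erase_cols thr S) = nnz S + q.
Proof. by rewrite cost_bind addn0 cost_erase_rows nnz_tr. Qed.

Lemma nnz_erase_cols p q thr (S : 'M[R]_(p, q)) :
  nnz (result (erase_cols thr S)) <= nnz S.
Proof. by rewrite bindE nnz_tr -[leqRHS]nnz_tr; apply: nnz_erase_rows. Qed.

Lemma cost_hh_reflect p q (v : 'cV[R]_p) (Y : 'M[R]_(p, q)) :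
  cost (hh_reflect v Y) <= 2 * p + 1 + q + 5 * p * q.
Proof.
rewrite /hh_reflect; split_cost; rewrite cost_dotM.
set w := result (gemm _ _); set b := result (fdiv _ _).
set bw := result (scaleM _ _).
have := cost_gemm v^T Y; have := cost_gemm v bw; have := cost_scaleM b w.
have := cost_mxsubM Y (result (gemm v bw)); rewrite [cost (fdiv _ _)]/=.
rewrite -/b; move: (cost _) (cost _) (cost _) (cost _) => *; nia.
Qed.

Lemma cost_hh_vector p q (Y : 'M[R]_(p, q)) j :
  cost (hh_vector Y j) <= 4 * p + 1.
Proof.
rewrite /hh_vector; split_cost; rewrite cost_dotM.
set F := (X in mxM X); have : cost (mxM F) <= p * 1 * 2.
  apply: cost_mxM_const => i o; rewrite /F; case: ifP => // _.
  by rewrite cost_bind; case: ifP.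
by rewrite [cost (fsqrt _)]/=; lia.
Qed.

Lemma size_hh_steps p q (st : 'M[R]_(p, q) * seq 'cV[R]_p) s :
  size (result (foldM (@hh_step R p q) st s)).2 = size st.2 + size s.
Proof. by elim: s st => [|j s IH] st /=; rewrite ?addn0 ?IH ?addnS. Qed.

(** Each of the [q] reflections is applied once to triangularize [Y] and once
   to assemble the orthonormal factor.  For [p = 0 < q] the bound fails, since
   a reflection still performs a division. *)
Lemma cost_qr p q (Y : 'M[R]_(p, q)) : 0 < p -> cost (qr Y) <= 23 * p * q ^ 2.
Proof.
move=> p0; rewrite /qr; split_cost; rewrite addn0.
set st := foldM _ _ _; set Q := foldM _ _ _.
have sz : size (result st).2 = q by rewrite size_hh_steps size_enum_ord.
have st_le : cost st <= q * (6 * p + 2 + q + 5 * p * q).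
  rewrite -[X in X * _](size_enum_ord q); apply: cost_foldM_const => y j.
  rewrite /hh_step; split_cost; rewrite addn0.
  have := cost_hh_vector y.1 j.
  by have := cost_hh_reflect (result (hh_vector y.1 j)) y.1; lia.
have Q_le : cost Q <= q * (2 * p + 1 + q + 5 * p * q).
  rewrite -[X in X * _]sz; apply: cost_foldM_const => y v.
  exact: cost_hh_reflect.
have qq : q <= q ^ 2 by rewrite expnS expn1; nia.
by move: st_le Q_le qq; rewrite !expnS expn0 muln1; nia.
Qed.

Lemma cost_phi_mul p q r (S : 'M[R]_(p, q)) d (Q : 'M[R]_(q, r)) :
  cost (phi_mul S d Q) <= 4 * r * nnz S + 2 * q * r.
Proof.
rewrite /phi_mul; split_cost; rewrite !cost_spmm_add nnz_tr.
set dQ := mxM _; have : cost dQ <= q * r * 1 by apply: cost_mxM_const.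
set Z := mxsubM _ _; have : cost Z <= q * r by apply: cost_mxsubM.
by lia.
Qed.

Lemma cost_gs_step p q (V : 'M[R]_(p, q)) st j :
  cost (gs_step V st j) <= size st * (4 * p + 2 * q) + 3 * p + q + 1.
Proof.
rewrite /gs_step; split_cost; rewrite addn0 cost_dotM.
set f := foldM _ _ _; have f_le : cost f <= size st * (4 * p + 2 * q).
  apply: cost_foldM_const => y a; split_cost; rewrite addn0 cost_dotM.
  set r := result _; have := cost_scaleM r a.1; have := cost_scaleM r a.2.
  have := cost_mxsubM y.1 (result (scaleM r a.1)).
  by have := cost_mxsubM y.2 (result (scaleM r a.2)); lia.
set v := mxM _; have v_le : cost v <= p * 1 * 1 by apply: cost_mxM_const.
set c := mxM _; have c_le : cost c <= q * 1 * 1 by apply: cost_mxM_const.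
by rewrite [cost (fsqrt _)]/=; lia.
Qed.

(** The state grows by one vector per step, so that its final size bounds the
   cost of every step. *)
Lemma cost_gs_steps p q (V : 'M[R]_(p, q)) st s :
  cost (foldM (gs_step V) st s) <=
  size s * ((size st + size s) * (4 * p + 2 * q) + 3 * p + q + 1).
Proof.
elim: s st => [|j s IH] st //; rewrite [foldM _ _ _]/= cost_bind.
have := cost_gs_step V st j; have := IH (result (gs_step V st j)).
have -> : size (result (gs_step V st j)) = (size st).+1.
  by rewrite /gs_step !bindE size_rcons.
rewrite [size (j :: s)]/=; move: (size s) (size st) => a b.
rewrite addSnnS; set c := _ * (4 * p + 2 * q) + _ + _ + _.
set e := b * _ + _ + _ + _; suff : e <= c by rewrite mulSn; lia.
by rewrite /e /c !leq_add2r leq_mul2r leq_addr orbT.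
Qed.

Lemma cost_gram_schmidt p q (V : 'M[R]_(p, q)) :
  q <= p -> cost (gram_schmidt V) <= 11 * p * q ^ 2.
Proof.
move=> qp; rewrite cost_bind addn0.
have := cost_gs_steps V [::] (enum 'I_q); rewrite size_enum_ord add0n => le.
apply: leq_trans le _; case: q V qp => // q _ qp.
by rewrite !expnS expn0 muln1; nia.
Qed.

Lemma nnz_split a b p q (gamma : 'I_p -> 'I_q -> {set 'I_b})
    (B : 'M[R]_(p, q)) i : nnz (result (Defs.split a gamma B) i) <= nnz B.
Proof.
by apply: leq_nnz => u v; rewrite mxE; case: ifP => // _; rewrite eqxx.
Qed.

Definition power_iters l : nat := `|Num.ceil (10 * ln (l%:R : R))%R|%N.

Lemma cost_SPCA m l k (G : 'M[R]_(l, k)) (B : 'M[R]_(m, l)) :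
  0 < l -> 0 < k ->
  cost (SPCA G B) <=
  (power_iters l).+1 * (4 * k * nnz B + 29 * l * k ^ 2) + m.
Proof.
move=> l0 k0; rewrite /SPCA.
split_cost; rewrite cost_erase_rows cost_sp_colsq.
set thr := result (fmax _ _); set Bt := result (erase_rows thr B).
have Bt_le : nnz Bt <= nnz B by apply: nnz_erase_rows.
set d := result (sp_colsq _); set Q0 := qr _.
have Q0_le : cost Q0 <= 23 * l * k ^ 2 by apply: cost_qr.
set F := foldM _ _ _.
have F_le : cost F <= power_iters l * (4 * k * nnz B + 25 * l * k ^ 2).
  rewrite -[X in X * _](size_iota 0); apply: cost_foldM_const => Q _.
  split_cost; rewrite addn0.
  have := cost_phi_mul Bt d Q; set Z := result _.
  have := cost_qr Z l0; rewrite !expnS expn0 muln1 /Z.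
  move: (cost _) (cost _) => c1 c2 h1 h2; apply: leq_trans (leq_add h2 h1) _.
  by nia.
have := cost_density B.
rewrite ![cost (fmul _ _)]/= [cost (fmax _ _)]/= [cost (Defs.charge _ _)]/=.
move: Q0_le F_le; rewrite !expnS expn0 muln1.
move: (cost _) (cost _) (cost _) (power_iters l) => c1 c2 c3 T h1 h2 h3.
by nia.
Qed.

End KernelCosts.

(** * Cost of the streaming algorithm *)

Section SMCCost.
Variable R : realType.
Local Open Scope nat_scope.

Lemma sum_nnz_col m n (A : 'M[R]_(m, n)) : \sum_(t < n) nnz (col t A) = nnz A.
Proof.
rewrite nnzE exchange_big; apply: eq_bigr => t _ /=; rewrite nnzE.
by apply: eq_bigr => i _; rewrite big_ord1 mxE.
Qed.

Lemma cost_smc_column m n k (A : 'M[R]_(m, n)) gamma (W : 'M[R]_(m, k)) st t :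
  cost (smc_column A gamma W st t) <= nnz (col t A) * (4 * k + 1).
Proof.
rewrite /smc_column; split_cost; rewrite addn0 !cost_spmm_add.
set At := Defs.split _ _ _.
have le i : nnz (result At i) <= nnz (col t A) by apply: nnz_split.
have := le 0%R; have := le 1%R; rewrite nnz_tr [cost At]/=.
move: (nnz _) (nnz _) (nnz _) => x y z; nia.
Qed.

(** The bound on one step depends on the arriving column only and not on the
   current state, so that the steps add up to the observed entries of [A]. *)
Lemma cost_smc_stream m n k (A : 'M[R]_(m, n)) gamma (W : 'M[R]_(m, k)) st
    (P : pred 'I_n) :
  cost (foldM (smc_column A gamma W) st [seq t <- enum 'I_n | P t]) <=
  nnz A * (4 * k + 1).
Proof.
apply: leq_trans (cost_foldM_le _ _ (cost_smc_column A gamma W)) _.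
rewrite big_filter big_enum_cond -big_distrl leq_mul2r -sum_nnz_col.
by rewrite [leqRHS](bigID P) leq_addr orbT.
Qed.

(** Every sparse operand of [SMC] consists of entries of the observed matrix,
   so that the cost is governed by the number of observed entries in the first
   [l] columns, which enter [SPCA] and hence get multiplied by the number of
   power iterations, and in the whole matrix, which are visited a constant
   number of times for each of the [k] factors.  The remaining terms come from
   the dense orthonormalizations and products. *)
Lemma cost_SMC m n k l (A : 'M[R]_(m, n)) (gamma : 'I_m * 'I_n -> {set 'I_4})
    (G : 'M[R]_(l, k)) :
  0 < l -> 0 < k <= n ->
  cost (SMC A gamma G) <=
  (power_iters R l).+1 * (14 * k * nnz (first_cols l A) + 36 * l * k ^ 2) +
  5 * k * nnz A + 11 * n * k ^ 2 + 7 * m * k ^ 2.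
Proof.
move=> l0 /andP[k0 kn]; rewrite /SMC; split_cost.
rewrite cost_erase_rows cost_erase_cols !cost_spmm_add nnz_tr addn0.
set z := nnz (first_cols l A); set T := power_iters R l.
set B := Defs.split 4 _ _.
have Bz i : nnz (result B i) <= z by apply: nnz_split.
rewrite [cost B]/= -/z [cost (fdiv _ _)]/= ![cost (fmul _ _)]/=.
have dhat_le : cost (batch_density l A) <= z + 2 by apply: cost_density.
set B2r := result (erase_rows _ _); set B2 := result (erase_cols _ _).
have B2r_le : nnz B2r <= z by apply: leq_trans (nnz_erase_rows _ _) (Bz _).
have B2_le : nnz B2 <= z by apply: leq_trans (nnz_erase_cols _ _) _.
set Q := SPCA _ _; set st := foldM _ _ _.
have Q_le : cost Q <= T.+1 * (4 * k * z + 29 * l * k ^ 2) + m.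
  apply: leq_trans (cost_SPCA _ _ l0 k0) _.
  by rewrite leq_add2r leq_mul2l leq_add2r leq_mul2l Bz !orbT.
have st_le : cost st <= nnz A * (4 * k + 1) by apply: cost_smc_stream.
set gs := gram_schmidt _.
have gs_le : cost gs <= 11 * n * k ^ 2 by apply: cost_gram_schmidt.
have B1_le := Bz 1%R; have B2'_le := Bz 2%R; have B3_le := Bz 3%R.
set IR := gemm _ (result gs); have IR_le : cost IR <= m * k * (2 * k).
  exact: cost_gemm.
set IRR := gemm (result IR) _; have IRR_le : cost IRR <= m * k * (2 * k).
  exact: cost_gemm.
set U := scaleM _ _; have U_le : cost U <= m * k by apply: cost_scaleM.
(* Lower-order terms are dominated monomial by monomial; after that the
   inequality is linear in the products below. *)
have kz : z <= k * z by rewrite leq_pmull.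
have kZ : nnz A <= k * nnz A by rewrite leq_pmull.
have kk : k <= k ^ 2 by rewrite -[leqLHS]expn1 leq_pexp2l.
have lk : l <= l * k ^ 2 by rewrite leq_pmulr // expn_gt0 k0.
have mk : m * k <= m * k ^ 2 by rewrite leq_mul2l kk orbT.
have m1 : m <= m * k by rewrite leq_pmulr.
have Tz : 10 * (k * z) + 7 * (l * k ^ 2) <=
    T.+1 * (10 * (k * z) + 7 * (l * k ^ 2)) by rewrite leq_pmull.
have mul_k x y : x <= y -> k * x <= k * y.
  by move=> xy; rewrite leq_mul2l xy orbT.
have kB2 := mul_k _ _ B2_le; have kB2' := mul_k _ _ B2'_le.
have kB3 := mul_k _ _ B3_le.
move: Q_le st_le gs_le IR_le IRR_le U_le dhat_le kz kZ kk lk mk m1 Tz.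
move: B1_le B2r_le kB2 kB2' kB3; rewrite -!mulnA.
have -> : m * (k * (2 * k)) = 2 * (m * k ^ 2) by rewrite -mulnn; lia.
have -> : nnz A * (4 * k + 1) = 4 * (k * nnz A) + nnz A by lia.
have TE a b x y : T.+1 * (a * x + b * y) = a * (T.+1 * x) + b * (T.+1 * y).
  by rewrite mulnDr !(mulnCA T.+1).
rewrite !TE.
move: (cost _) (cost _) (cost _) (cost _) (cost _) (cost _) (cost _).
move: (k * nnz (result B 2%R)) (k * nnz (result B 3%R)).
move: (k * nnz B2) (k * nnz A).
move: (k * z) (l * k ^ 2) => x y; move: (T.+1 * x) (T.+1 * y).
move: (m * k ^ 2) (n * k ^ 2) (m * k) (k ^ 2).
by lia.
Qed.

End SMCCost.

(** * Tail bound for Bernoulli random sets *)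

Section BernoulliSampling.
Variable R : realType.

(** Probability that a random subset, containing each point independently with
   probability [delta], is equal to [S]. *)
Definition bernoulli_weight (I : finType) (delta : R) (S : {set I}) : R :=
  delta ^+ #|S| * (1 - delta) ^+ (#|I| - #|S|).

Lemma bernoulli_weight_ge0 (I : finType) (delta : R) (S : {set I}) :
  0 <= delta <= 1 -> 0 <= bernoulli_weight delta S.
Proof. by case/andP=> d0 d1; rewrite mulr_ge0 // exprn_ge0 // subr_ge0. Qed.

(** The generating function of the number of sampled points in [D]: it
   factorizes since the points are sampled independently. *)
Lemma bernoulli_gf (I : finType) (delta : R) (D : {set I}) (c : R) :
  \sum_(S : {set I}) bernoulli_weight delta S * c ^+ #|(S :&: D)%SET| =
  (1 + delta * (c - 1)) ^+ #|D|.
Proof.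
pose F i := delta * (if i \in D then c else 1).
have -> : (1 + delta * (c - 1)) ^+ #|D| = \prod_i (F i + (1 - delta)).
  rewrite (bigID (mem D)) /= -[LHS]mulr1; congr (_ * _).
    rewrite -prodr_const; apply: eq_bigr => i iD.
    by rewrite /F iD; ring.
  rewrite big1 // => i iD; rewrite /F (negbTE iD) mulr1 addrC subrK //.
rewrite bigA_distr; apply: eq_bigr => S _.
rewrite (bigID (mem S)) /= (eq_bigr F) => [|i ->//].
rewrite [X in _ = _ * X](eq_bigr (fun=> 1 - delta)); last first.
  by move=> i /negbTE ->.
rewrite big_split /= !prodr_const -mulrAC /bernoulli_weight; congr (_ * _ * _).
  by rewrite -big_mkcondr /= -prodr_const; apply: eq_bigl => i; rewrite inE.
by rewrite -(cardC (mem S)) addKn.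
Qed.

(** Chernoff bound, with the generating function taken at [e]: if the mean
   number of sampled points in [D] is at most [a], then [e a] is exceeded with
   probability at most [exp (- a)], which is below [1 / a]. *)
Lemma bernoulli_tail (I : finType) (delta : R) (D : {set I}) (a : R) :
  0 <= delta <= 1 -> 0 < a -> delta * #|D|%:R <= a ->
  \sum_(S : {set I} | expR 1 * a < #|(S :&: D)%SET|%:R) bernoulli_weight delta S
    <= a^-1.
Proof.
move=> d01 a0 Da; set e := expR 1.
have e1 : 0 <= e - 1 by rewrite subr_ge0 -expR0 ler_expR.
pose t := expR (- (e * a)).
apply: (@le_trans _ _ (t * \sum_(S : {set I}) bernoulli_weight delta S *
                           e ^+ #|(S :&: D)%SET|)).
  rewrite big_mkcond mulr_sumr; apply: ler_sum => S _.
  have w0 := bernoulli_weight_ge0 S d01.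
  case: ifP => [aS|_]; last first.
    by apply: mulr_ge0; rewrite ?expR_ge0 // mulr_ge0 // exprn_ge0 // expR_ge0.
  rewrite mulrCA -[leLHS]mulr1 ler_wpM2l // -expRM_natl mulr1 -expRD.
  by rewrite -[leLHS]expR0 ler_expR addrC subr_ge0 ltW.
rewrite bernoulli_gf.
apply: (@le_trans _ _ (t * expR (a * (e - 1)))).
  rewrite ler_wpM2l ?expR_ge0 //.
  apply: (@le_trans _ _ (expR (delta * (e - 1)) ^+ #|D|)).
    have d0 : 0 <= delta * (e - 1) by case/andP: d01 => ? _; rewrite mulr_ge0.
    by rewrite lerXn2r ?nnegrE ?expR_ge0 ?addr_ge0 // expR_ge1Dx.
  by rewrite -expRM_natl ler_expR mulrA [_ * delta]mulrC ler_wpM2r.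
rewrite -expRD (_ : _ + _ = - a); last by ring.
rewrite expRN lef_pV2 ?posrE ?expR_gt0 //.
by apply: le_trans (expR_ge1Dx a); rewrite lerDr.
Qed.

End BernoulliSampling.

(** * Joint law of the sample and the order of arrival *)

Section SamplingModel.
Variable R : realType.

Lemma bigsetU_probability_le d (T : measurableType d) (P : probability T R)
    (I : Type) (r : seq I) (Q : pred I) (F : I -> set T) :
  (forall i, measurable (F i)) ->
  (P (\big[setU/set0]_(i <- r | Q i) F i) <= \sum_(i <- r | Q i) P (F i))%E.
Proof.
move=> mF; elim: r => [|i r IH]; first by rewrite !big_nil measure0.
rewrite !big_cons; case: ifP => // _.
have mU : measurable (\big[setU/set0]_(j <- r | Q j) F j).
  exact: bigsetU_measurable.
by apply: le_trans (measureU2 _ (mF i) mU) _; rewrite leeD2l.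
Qed.

Section Model.
Context d (T : measurableType d) (P : probability T R) (m n k l : nat).
Variables (delta : R) (M : 'M[R]_(m, n)) (X : 'I_m -> 'I_n -> {RV P >-> R}).
Variables (Om : T -> {set 'I_m * 'I_n}) (sg : T -> 'S_n).
Variables (gamma : T -> {ffun 'I_m * 'I_n -> {set 'I_4}}).
Variables (G : T -> 'M[R]_(l, k)) (A : T -> 'M[R]_(m, n)).
Hypothesis model : smc_model delta M X Om sg gamma G A.

Lemma sample_order_law S s :
  P [set w | Om w = S /\ sg w = s] =
  (bernoulli_weight delta S * (n`!%:R)^-1)%:E.
Proof.
have := sampling_law model S s (B := fun _ _ => setT) (fun _ _ => measurableT).
rewrite big1 ?mul1e => [|i _]; last first.
  by rewrite big1 // => j _; rewrite preimage_setT probability_setT.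
rewrite /bernoulli_weight card_prod !card_ord => <-; congr (P _).
by apply/seteqP; split => w /=; [case=> ? ?; split | case].
Qed.

(** Conditionally on the order of arrival, [Om] is still a Bernoulli sample;
   hence a bound that holds for every fixed order holds overall. *)
Lemma sample_event_le (bad : {set 'I_m * 'I_n} -> 'S_n -> bool) (b : R) :
  (forall s, \sum_(S | bad S s) bernoulli_weight delta S <= b) ->
  measurable [set w | bad (Om w) (sg w)] /\
  (P [set w | bad (Om w) (sg w)] <= b%:E)%E.
Proof.
move=> bad_le.
pose F (x : 'S_n * {set 'I_m * 'I_n}) := [set w | Om w = x.2 /\ sg w = x.1].
have mF x : measurable (F x).
  have -> : F x = Om @^-1` [set x.2] `&` sg @^-1` [set x.1] by [].
  apply: measurableI; first exact: (measurable_Om model).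
  exact: (measurable_sg model).
have -> : [set w | bad (Om w) (sg w)] =
          \big[setU/set0]_(x | bad x.2 x.1) F x.
  rewrite -(bigcup_pred [pred x | bad x.2 x.1]); apply/seteqP; split=> w /=.
    by move=> badw; exists (sg w, Om w).
  by case=> -[s S] /= bad_sS [-> ->].
split; first exact: bigsetU_measurable.
apply: le_trans (bigsetU_probability_le _ _ _ mF) _.
rewrite (eq_bigr (fun x => (bernoulli_weight delta x.2 * (n`!%:R)^-1)%:E));
  last by move=> x _; apply: sample_order_law.
rewrite sumEFin lee_fin -(pair_big_dep xpredT (fun s S => bad S s)
  (fun s S => bernoulli_weight delta S * (n`!%:R)^-1)) /=.
rewrite (eq_bigr (fun s => (\sum_(S | bad S s) bernoulli_weight delta S) *
  (n`!%:R)^-1)); last by move=> s _; rewrite mulr_suml.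
apply: (@le_trans _ _ (\sum_(s : 'S_n) b * (n`!%:R)^-1)).
  by apply: ler_sum => s _; rewrite ler_wpM2r ?invr_ge0 ?ler0n.
rewrite sumr_const card_Sn -[leLHS]mulr_natr mulfVK // pnatr_eq0 -lt0n fact_gt0.
Qed.

End Model.
End SamplingModel.

(** * Counting observed entries *)

Section ObservedEntries.
Variable R : realType.
Local Open Scope nat_scope.

(** The order of arrival [s] maps times to columns, so that its inverse gives
   the time at which a column arrives; positions refer to the original numbering
   of the columns, the one in which the sample is drawn. *)
Definition batch m n (s : 'S_n) (l : nat) : {set 'I_m * 'I_n} :=
  finset (fun x : 'I_m * 'I_n => (s^-1)%g x.2 < l).

(** The padding columns of [first_cols], present when [n < l], are zero. *)
Lemma sum_insub_le n l (f : 'I_n -> nat) :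
  \sum_(t < l) (if insub (t : nat) is Some t' then f t' else 0) <=
  \sum_(t < n | t < l) f t.
Proof.
pose g (i : nat) := if insub i is Some t' then f t' else 0.
rewrite [leqRHS](eq_bigr (fun t : 'I_n => g t)); last first.
  by move=> t _; rewrite /g valK.
have [ln|nl] := leqP l n; first by rewrite (big_ord_widen n g ln).
rewrite [leqRHS](eq_bigl xpredT) => [|t]; last by rewrite (ltn_trans _ nl).
rewrite (big_ord_widen l g (ltnW nl)) [leqRHS]big_mkcond.
apply: leq_sum => t _; case: ifP => // tn; rewrite /g insubN //.
by rewrite tn.
Qed.

Lemma card_pairs m n (S : {set 'I_m * 'I_n}) :
  #|S| = \sum_(u < m) \sum_(v < n) ((u, v) \in S).
Proof.
rewrite pair_big /= -sum1_card big_mkcond.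
by apply: eq_bigr => -[u v] _ /=; case: (_ \in S).
Qed.

Lemma card_batch m n (s : 'S_n) l : #|batch m s l| <= m * l.
Proof.
rewrite card_pairs (eq_bigr (fun=> \sum_(t < n | t < l) 1)) => [|u _];
  last first.
  rewrite (reindex_inj (@perm_inj _ s)) [RHS]big_mkcond /=.
  by apply: eq_bigr => t _; rewrite inE /= permK; case: ltnP.
rewrite sum_nat_const card_ord.
rewrite leq_mul2l; apply/orP; right; have [ln|nl] := leqP l n.
  by rewrite -(big_ord_widen n (fun=> 1) ln) sum1_card card_ord.
by rewrite sum1_card; apply: leq_trans (max_card _) _; rewrite card_ord ltnW.
Qed.

Section FixedSample.
Variables (m n : nat) (Y : 'M[R]_(m, n)) (S : {set 'I_m * 'I_n}) (s : 'S_n).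
Let A := col_perm s (sample S Y).

Lemma observed_entry u t : (A u t != 0%R) <= ((u, s t) \in S).
Proof. by rewrite !mxE; case: ifP => _; rewrite ?eqxx ?leq_b1. Qed.

Lemma nnz_observed : nnz A <= #|S|.
Proof.
rewrite nnzE card_pairs.
apply: leq_sum => u _; rewrite [leqRHS](reindex_inj (@perm_inj _ s)).
by apply: leq_sum => t _; apply: observed_entry.
Qed.

Lemma nnz_first_cols_observed l :
  nnz (first_cols l A) <= #|(S :&: batch m s l)%SET|.
Proof.
rewrite nnzE card_pairs.
apply: leq_sum => u _; rewrite [leqRHS](reindex_inj (@perm_inj _ s)).
rewrite (eq_bigr (fun t : 'I_l => if insub (t : nat) is Some t'
  then ((A u t' != 0%R) : nat) else 0)) => [|t _]; last first.
  by rewrite mxE; case: insub => [t'|]; rewrite ?eqxx.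
apply: leq_trans (sum_insub_le _ _) _; rewrite big_mkcond.
apply: leq_sum => t _; rewrite !inE /= permK.
by have := observed_entry u t; case: (_ \in S); case: ltnP.
Qed.

End FixedSample.
End ObservedEntries.

(** * Balance of the parameters *)

Section Scaling.
Variable R : realType.

Lemma power_iters_le (m l : nat) :
  (0 < l <= m)%N -> 1 <= ln (m%:R : R) ->
  (power_iters R l)%:R <= 11 * ln (m%:R : R).
Proof.
case/andP=> l0 lm m1.
have ln_lm : ln (l%:R : R) <= ln (m%:R).
  by rewrite ler_ln ?posrE ?ltr0n ?ler_nat // (leq_trans l0).
have ln_l0 : 0 <= ln (l%:R : R) by rewrite ln_ge0 // ler1n.
rewrite /power_iters natr_absz ger0_norm ?ceil_ge0; last first.
  by apply: lt_le_trans (mulr_ge0 _ ln_l0); rewrite ?ltrN10.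
have := ceilB1_lt (10 * ln (l%:R : R)); rewrite intrB.
lra.
Qed.

(** The arithmetic of the cost bound.  Since [l] is about [k / (delta ln m)]
   and at most [m], the power iterations contribute
   [power_iters * l = O (ln m) * O (k / (delta ln m)) = O (k / delta)]: the
   logarithm in the number of iterations is compensated by that in the size of
   the batch.  The remaining factors are absorbed by [k <= delta m] and
   [k <= delta n]. *)
Lemma cost_bound_le (m n k l z Z : nat) (delta c : R) :
  (0 < k)%N -> 0 <= delta -> 0 <= c -> 2 <= ln (m%:R : R) ->
  k%:R <= delta * n%:R -> k%:R * ln (m%:R : R) ^+ 2 <= delta * m%:R ->
  delta * ln (m%:R : R) ^+ 2 <= 1 ->
  `|l%:R - k%:R / (delta * ln (m%:R : R))| < 1 ->
  z%:R <= c * (delta * (m * l)%:R) -> Z%:R <= c * (delta * (m * n)%:R) ->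
  (0 < l)%N /\
  (((power_iters R l).+1 * (14 * k * z + 36 * l * k ^ 2) + 5 * k * Z +
    11 * n * k ^ 2 + 7 * m * k ^ 2)%N)%:R
  <= (341 * c + 882) * (delta * (k * m * n)%:R).
Proof.
set lam := ln _ => k0 d0 c0 lam2 kn km dlam lP zP ZP.
have lam0 : 0 < lam by apply: lt_le_trans lam2.
have k1 : 1 <= k%:R :> R by rewrite ler1n.
have k_gt0 : 0 < k%:R :> R by rewrite ltr0n.
have d_gt0 : 0 < delta.
  rewrite lt_neqAle d0 andbT; apply/eqP => d00.
  by move: kn; rewrite -d00 mul0r; lra.
set L := k%:R / (delta * lam) in lP.
have LE : L * (delta * lam) = k%:R by rewrite mulfVK // mulf_neq0 ?gt_eqF.
have L0 : 0 < L by rewrite divr_gt0 // mulr_gt0.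
have lamL : lam <= L.
  rewrite ler_pdivlMr ?mulr_gt0 //.
  by apply: le_trans k1; apply: le_trans dlam; rewrite mulrCA -expr2.
move: lP; rewrite ltr_norml => /andP[lL Ll].
have l0 : (0 < l)%N by rewrite -(ltr0n R); lra.
have l2L : l%:R <= 2 * L by lra.
(* [k lam^2 <= delta m] reads [L lam^3 <= m], and [lam >= 2]. *)
have Lm : 2 * L <= m%:R.
  have : L * lam ^+ 3 <= m%:R.
    rewrite -(ler_pM2l d_gt0); apply: le_trans km; rewrite -LE.
    by rewrite le_eqVlt; apply/orP; left; apply/eqP; ring.
  have : 2 * 1 <= lam ^+ 3.
    by rewrite exprS ler_pM // exprn_ege1; lra.
  nra.
have lm : (l <= m)%N by rewrite -(ler_nat R); lra.
have T_le : (power_iters R l).+1%:R <= 12 * lam.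
  have := @power_iters_le m l; rewrite l0 lm => /(_ isT); rewrite -/lam => h.
  by rewrite -natr1; have := h ltac:(lra); lra.
set T := (power_iters R l).+1 in T_le *.
have Tl : delta * (T%:R * l%:R) <= 24 * k%:R.
  rewrite -LE (_ : 24 * _ = delta * ((12 * lam) * (2 * L))); last by ring.
  by rewrite ler_wpM2l // ler_pM.
have km' : k%:R <= delta * m%:R.
  by apply: le_trans km; rewrite ler_peMr ?ler0n // exprn_ege1; lra.
rewrite !(natrD, natrM, natrX) in zP ZP *.
split=> //.
set K := k%:R in k1 k_gt0 kn km km' LE Tl *.
set mr := m%:R in km km' zP ZP Lm *; set nr := n%:R in kn ZP *.
set lr := l%:R in zP Tl *; set t := T%:R in Tl *.
have m0 : 0 <= mr by apply: ler0n.
have n0 : 0 <= nr by apply: ler0n.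
have t0 : 0 <= t by apply: ler0n.
have lr0 : 0 <= lr by apply: ler0n.
have K0 := ltW k_gt0.
set W := delta * (K * mr * nr).
have kkm : K ^+ 2 * mr <= W.
  rewrite expr2 (_ : W = K * mr * (delta * nr)); last by rewrite /W; ring.
  by rewrite mulrAC ler_wpM2l ?mulr_ge0.
have kkn : K ^+ 2 * nr <= W.
  rewrite expr2 (_ : W = K * nr * (delta * mr)); last by rewrite /W; ring.
  by rewrite mulrAC ler_wpM2l ?mulr_ge0.
have h1 : t * (K * z%:R) <= 24 * c * W.
  apply: (@le_trans _ _ (c * (K * mr * (delta * (t * lr))))).
    rewrite (_ : c * _ = t * (K * (c * (delta * (mr * lr))))); last by ring.
    by rewrite !ler_wpM2l.
  rewrite -[leRHS]mulrA [leRHS]mulrCA ler_wpM2l //.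
  apply: (@le_trans _ _ (K * mr * (24 * K))).
    by rewrite ler_wpM2l ?mulr_ge0.
  by move: kkm; rewrite expr2; lra.
have h2 : t * (lr * K ^+ 2) <= 24 * W.
  apply: (@le_trans _ _ ((delta * (t * lr)) * (delta * (mr * nr)))).
    rewrite (_ : _ * (delta * _) = t * (lr * ((delta * mr) * (delta * nr))));
      last by ring.
    by rewrite !ler_wpM2l // expr2 ler_pM.
  rewrite (_ : 24 * W = 24 * K * (delta * (mr * nr))); last by rewrite /W; ring.
  by rewrite ler_wpM2r // !mulr_ge0.
have h3 : K * Z%:R <= c * W.
  rewrite (_ : c * W = K * (c * (delta * (mr * nr)))); last by rewrite /W; ring.
  by rewrite ler_wpM2l.
rewrite (_ : (_ + _) * W = 14 * (24 * c * W) + 36 * (24 * W) + 5 * (c * W) +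
  11 * W + 7 * W); last by ring.
rewrite (_ : t * _ = 14 * (t * (K * z%:R)) + 36 * (t * (lr * K ^+ 2)));
  last by ring.
rewrite -(mulrA 5) -(mulrA 11) -(mulrA 7) [nr * _]mulrC [mr * _]mulrC.
lra.
Qed.

End Scaling.

(** * High-probability bound *)

(** Both counts are Chernoff bounds for the Bernoulli sample, the first one over
   the set of positions occupied by the first [l] arrivals, which is fixed once
   the order of arrival is. *)
Lemma observed_counts (R : realType) d (T : measurableType d)
    (P : probability T R) (m n k l : nat) (delta : R) (M : 'M[R]_(m, n))
    (X : 'I_m -> 'I_n -> {RV P >-> R}) (Om : T -> {set 'I_m * 'I_n})
    (sg : T -> 'S_n) (gamma : T -> {ffun 'I_m * 'I_n -> {set 'I_4}})
    (G : T -> 'M[R]_(l, k)) (A : T -> 'M[R]_(m, n)) :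
  smc_model delta M X Om sg gamma G A -> 0 <= delta <= 1 ->
  0 < delta * (m * l)%:R -> 0 < delta * (m * n)%:R ->
  exists2 F : set T, measurable F /\
    F `<=` [set w | (nnz (first_cols l (A w)))%:R
                      <= expR 1 * (delta * (m * l)%:R) /\
                    (nnz (A w))%:R <= expR 1 * (delta * (m * n)%:R)] &
    ((1 - ((delta * (m * l)%:R)^-1 + (delta * (m * n)%:R)^-1))%:E <= P F)%E.
Proof.
move=> model d01; set a := delta * (m * l)%:R; set b := delta * (m * n)%:R.
move=> a0 b0; have d0 : 0 <= delta by case/andP: d01.
pose bad (S : {set 'I_m * 'I_n}) (s : 'S_n) :=
  (expR 1 * a < #|(S :&: batch m s l)%SET|%:R) ||
  (expR 1 * b < #|(S :&: [set: 'I_m * 'I_n])%SET|%:R).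
have bad_le s : \sum_(S | bad S s) bernoulli_weight delta S <= a^-1 + b^-1.
  apply: le_trans (lerD (bernoulli_tail (D := batch m s l) d01 a0 _)
                        (bernoulli_tail (D := [set: 'I_m * 'I_n]%SET) d01 b0 _)).
  - rewrite big_mkcond [X in _ <= X + _]big_mkcond [X in _ <= _ + X]big_mkcond.
    rewrite /= -big_split /=; apply: ler_sum => S _; rewrite /bad.
    have w0 := bernoulli_weight_ge0 S d01.
    by case: ifP => [/orP[->|->]|_]; do ?case: ifP => _;
      rewrite ?addr0 ?add0r ?lerDl ?addr_ge0.
  - by rewrite ler_wpM2l // ler_nat card_batch.
  - by rewrite cardsT card_prod !card_ord.
have [mE PE] := sample_event_le model bad_le.
exists (~` [set w | bad (Om w) (sg w)]).
  split; first exact: measurableC.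
  move=> w /= /negP; rewrite /bad negb_or -!leNgt finset.setIT => /andP[aw bw].
  rewrite (arrivalE model); split.
    by apply: le_trans aw; rewrite ler_nat nnz_first_cols_observed.
  by apply: le_trans bw; rewrite ler_nat nnz_observed.
by rewrite probability_setC // EFinB leeB.
Qed.

Theorem theorem7 (R : realType)
  (m n k l : nat -> nat) (delta : nat -> R)
  (M : forall N, 'M[R]_(m N, n N)) (s : nat -> seq R)
  (d : nat -> measure_display) (T : forall N, measurableType (d N))
  (P : forall N, probability (T N) R)
  (X : forall N, 'I_(m N) -> 'I_(n N) -> {RV (P N) >-> R})
  (Om : forall N, T N -> {set 'I_(m N) * 'I_(n N)})
  (sg : forall N, T N -> 'S_(n N))
  (gamma : forall N, T N -> {ffun 'I_(m N) * 'I_(n N) -> {set 'I_4}})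
  (G : forall N, T N -> 'M[R]_(l N, k N))
  (A : forall N, T N -> 'M[R]_(m N, n N))
  (m_oo : m @ \oo --> \oo) (n_oo : n @ \oo --> \oo)
  (M01 : forall N i j, 0 <= M N i j <= 1)
  (delta01 : forall N, 0 <= delta N <= 1)
  (sampled : forall N,
     smc_model (delta N) (M N) (@X N) (@Om N) (@sg N) (@gamma N) (@G N) (@A N))
  (sE : forall N, singular_values (M N) (s N))
  (frobM : (fun N => frob2 (M N)) =Theta_\oo (fun N => (m N * n N)%:R : R))
  (kP : smallest_spectral_gap m n (fun N i => (s N)`_i.-1) k)
  (delta_lb : (fun N => (k N)%:R *
       Num.max (1 / (n N)%:R) (ln (m N)%:R ^+ 2 / (m N)%:R)) =o_\oo delta)
  (delta_ub : delta =o_\oo (fun N => 1 / ln (m N)%:R ^+ 2))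
  (lP : forall N, `|(l N)%:R - (k N)%:R / (delta N * ln (m N)%:R)| < 1) :
  exists2 C : R, 0 < C &
    whp P (fun N => [set w |
      (cost (SMC (A N w) (gamma N w) (G N w)))%:R
        <= C * (delta N * (k N * m N * n N)%:R)]).
Proof.
have near_lb c : 0 < c -> \forall N \near \oo,
    (k N)%:R <= c * (delta N * (n N)%:R) /\
    (k N)%:R * ln ((m N)%:R : R) ^+ 2 <= c * (delta N * (m N)%:R).
  move=> c0; have /eqoP/(_ c c0) lb := delta_lb.
  have n1 : \forall N \near \oo, (1 <= n N)%N by exact: (cvgnyPge n).1.
  have m1 : \forall N \near \oo, (1 <= m N)%N by exact: (cvgnyPge m).1.
  near=> N.
  have n0 : 0 < (n N)%:R :> R by rewrite ltr0n; near: N.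
  have m0 : 0 < (m N)%:R :> R by rewrite ltr0n; near: N.
  have [d0 _] := andP (delta01 N).
  have : (k N)%:R * Num.max (1 / (n N)%:R) (ln (m N)%:R ^+ 2 / (m N)%:R)
    <= c * delta N.
    rewrite -[X in _ <= _ * X](ger0_norm d0); apply: le_trans (ler_norm _) _.
    by near: N.
  set mx := Num.max _ _ => kmx.
  have [h1 h2] : 1 / (n N)%:R <= mx /\ ln (m N)%:R ^+ 2 / (m N)%:R <= mx.
    by rewrite /mx !le_max !lexx orbT.
  split; rewrite [leRHS]mulrA -ler_pdivrMr //.
    by apply: le_trans kmx; rewrite -[X in X / _]mulr1 -mulrA ler_wpM2l ?ler0n.
  by apply: le_trans kmx; rewrite -mulrA ler_wpM2l ?ler0n.
(* The constant of [cost_bound_le] for counts at most [e] times their mean. *)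
exists (341 * expR 1 + 882); first by have := expR_gt0 (1 : R); lra.
move=> eps eps0.
have lb1 := near_lb 1 ltr01.
have e2 : 0 < eps / 2 by rewrite divr_gt0.
have lb2 := near_lb _ e2.
have /eqoP/(_ 1 ltr01) ub := delta_ub.
have k_near : \forall N \near \oo, (1 <= k N <= minn (m N) (n N))%N.
  by have [[]] := kP.
have m_near : \forall N \near \oo, expR 2 <= (m N)%:R :> R.
  have [N0 _ N0P] := nbhs_infty_ger (expR 2 : R).
  have mN0 : \forall N \near \oo, (N0 <= m N)%N by exact: (cvgnyPge m).1.
  by apply: filterS mN0 => N; apply: N0P.
near=> N.
have /andP[k0] : (1 <= k N <= minn (m N) (n N))%N by near: N.
rewrite leq_min => /andP[_ kn].
have lam2 : 2 <= ln ((m N)%:R : R).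
  have m_ge : expR 2 <= (m N)%:R :> R by near: N.
  rewrite -[leLHS]expRK ler_ln // posrE; first exact: expR_gt0.
  exact: lt_le_trans (expR_gt0 2) m_ge.
have [d0 d1] := andP (delta01 N).
have [kdn kdm] : (k N)%:R <= 1 * (delta N * (n N)%:R) /\
    (k N)%:R * ln ((m N)%:R : R) ^+ 2 <= 1 * (delta N * (m N)%:R) by near: N.
have [_ kdm2] : (k N)%:R <= eps / 2 * (delta N * (n N)%:R) /\
    (k N)%:R * ln ((m N)%:R : R) ^+ 2 <= eps / 2 * (delta N * (m N)%:R).
  by near: N.
rewrite mul1r in kdn; rewrite mul1r in kdm.
have dub : delta N * ln ((m N)%:R : R) ^+ 2 <= 1.
  have : `|delta N| <= 1 * `|1 / ln ((m N)%:R : R) ^+ 2| by near: N.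
  rewrite mul1r !ger0_norm // ?divr_ge0 ?sqr_ge0 // ler_pdivlMr //.
  by rewrite exprn_gt0 //; lra.
have bound := cost_bound_le k0 d0 (expR_ge0 1) lam2 kdn kdm dub (lP N).
have l0 : (0 < l N)%N.
  by have [] := bound 0%N 0%N; rewrite ?mulr_ge0 ?expR_ge0 ?ler0n.
(* Both expected counts are at least [delta m >= 2 / eps], so that each of the
   two tail bounds is at most [eps / 2]. *)
have k1 : 1 <= (k N)%:R :> R by rewrite ler1n.
have dm : 1 <= eps / 2 * (delta N * (m N)%:R).
  apply: le_trans kdm2; rewrite -[leLHS]mulr1 ler_pM //.
  by rewrite exprn_ege1 //; lra.
have dm0 : 0 < delta N * (m N)%:R.
  by rewrite -(pmulr_rgt0 _ e2); apply: lt_le_trans dm.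
have count_large p : (0 < p)%N ->
    0 < delta N * (m N * p)%:R /\ (delta N * (m N * p)%:R)^-1 <= eps / 2.
  move=> p0; have h : delta N * (m N)%:R <= delta N * (m N * p)%:R.
    by rewrite ler_wpM2l // ler_nat leq_pmulr.
  have h0 := lt_le_trans dm0 h; split=> //.
  by rewrite -div1r ler_pdivrMr // (le_trans dm) // ler_wpM2l // ltW.
have [a0 a_eps] := count_large _ l0.
have [b0 b_eps] := count_large _ (leq_trans k0 kn).
have [F [mF FE] PF] := observed_counts (sampled N) (delta01 N) a0 b0.
exists F; last first.
  by apply: le_trans PF; rewrite lee_fin; lra.
split=> // w /FE[zw Zw] /=.
apply: le_trans (bound _ _ zw Zw).2.
by rewrite ler_nat cost_SMC // k0.
Unshelve. all: by end_near.
Qed.
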